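(* Let $\beta\in(1,2)$. The Bernoulli convolution $\nu_\beta$ is absolutely continuous (with respect to Lebesgue measure) if and only if \[ 0<\int_{I_\beta}\overline f(x)\,dx<\infty . \] Moreover, in this case $\int_{I_\beta}\overline f(x)\,dx\le 2$, and if $h_\beta$ denotes the density of $\nu_\beta$ then \[ h_\beta(x)=\frac{\overline f(x)}{\int_{I_\beta}\overline f(y)\,dy} \] for Lebesgue almost every $x\in I_\beta$.
   Context: For $\beta\in(1,2)$ let $I_\beta:=\left[0,\frac{1}{\beta-1}\right]$. A $\beta$-expansion of $x\in I_\beta$ is a sequence $(x_i)_{i\ge1}\in\{0,1\}^{\mathbb N}$ with $x=\sum_{i=1}^\infty x_i\beta^{-i}$. For $n\in\mathbb N$ put \[ \mathcal E^n_\beta(x):=\Big\{(x_1,\dots,x_n)\in\{0,1\}^n : \exists (x_{n+1},x_{n+2},\dots)\in\{0,1\}^{\mathbb N}\text{ with } x=\sum_{k=1}^\infty x_k\beta^{-k}\Big\}, \] and $\mathcal N_n(x;\beta):=|\mathcal E^n_\beta(x)|$. Define $f_n:I_\beta\to\mathbb R$ by \[ f_n(x):=\frac{(\beta-1)\beta^n}{2^n}\,\mathcal N_n(x;\beta), \] and $\overline f(x):=\limsup_{n\to\infty}f_n(x)\in[0,\infty]$. The Bernoulli convolution $\nu_\beta$ is the probability measure defined as the weak-star limit as $n\to\infty$ of the measures \[ \nu_{\beta,n}:=\frac1{2^n}\sum_{(a_1,\dots,a_n)\in\{0,1\}^n}\delta_{\sum_{i=1}^n a_i\beta^{-i}}, \]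 where $\delta_x$ is the Dirac measure at $x$. *)

(* Defs.v *)
From HB Require Import structures.
From mathcomp Require Import all_boot all_order all_algebra.
From mathcomp Require Import all_classical all_reals all_analysis.

Set Implicit Arguments.
Unset Strict Implicit.
Unset Printing Implicit Defensive.

Import Order.TTheory GRing.Theory Num.Theory.
Import numFieldNormedType.Exports.

Local Open Scope classical_set_scope.
Local Open Scope ring_scope.

Section expansions.
Context {R : realType}.
Implicit Types (beta x : R) (n : nat).

Definition Ibeta beta : set R := `[0, (beta - 1)^-1].

(* Digits are indexed from 0: [s k] is the digit x_(k+1). *)
Definition is_expansion beta x (s : nat -> bool) : Prop :=
  series (fun k => (s k)%:R * beta ^- k.+1) @ \oo --> x.

Definition expansion_prefixes n beta x : {set n.-tuple bool} :=
  [set a : n.-tuple bool | `[< exists s : nat -> bool,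
     (forall i : 'I_n, s i = tnth a i) /\ is_expansion beta x s >]]%SET.

Definition nb_prefixes n beta x : nat := #|expansion_prefixes n beta x|.

Definition fn beta n x : R :=
  (beta - 1) * beta ^+ n / 2 ^+ n * (nb_prefixes n beta x)%:R.

Definition fbar beta x : \bar R := limn_esup (fun n => (fn beta n x)%:E).

End expansions.

Section bernoulli.
Context {R : realType}.
Variable beta : R.
Local Open Scope ereal_scope.

Definition partial_value n (a : n.-tuple bool) : R :=
  (\sum_(i < n) (tnth a i)%:R * beta ^- i.+1)%R.

Definition bernoulli_approx n (A : set (measurableTypeR R)) : \bar R :=
  (2 ^- n)%:E * \sum_(a : n.-tuple bool) \d_(partial_value a) A.

Section bernoulli_approx_measure.
Variable n : nat.

Let bernoulli_approx0 : bernoulli_approx n set0 = 0.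
Proof. by rewrite /bernoulli_approx big1 ?mule0// => a _; rewrite measure0. Qed.

Let bernoulli_approx_ge0 A : 0 <= bernoulli_approx n A.
Proof.
by rewrite /bernoulli_approx mule_ge0 ?lee_fin// sume_ge0.
Qed.

Let bernoulli_approx_sigma_additive : semi_sigma_additive (bernoulli_approx n).
Proof.
move=> F mF tF mUF; rewrite [X in X @ \oo --> _](_ : _ = (fun k =>
    (2 ^- n)%:E * \sum_(0 <= i < k)
      \sum_(a : n.-tuple bool) \d_(partial_value a) (F i))); last first.
  by apply/funext => k; rewrite ge0_sume_distrr// => i _; exact: sume_ge0.
rewrite /bernoulli_approx; apply: cvgeZl => //.
rewrite [X in _ --> X](_ : _ = lim ((fun k => \sum_(0 <= i < k)
    \sum_(a : n.-tuple bool) \d_(partial_value a) (F i)) @ \oo)).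
  by apply: is_cvg_ereal_nneg_natsum => k _; exact: sume_ge0.
rewrite nneseries_sum//; apply: eq_bigr => /= a _.
exact: measure_semi_bigcup.
Qed.

HB.instance Definition _ := isMeasure.Build _ _ _ (bernoulli_approx n)
  bernoulli_approx0 bernoulli_approx_ge0 bernoulli_approx_sigma_additive.

End bernoulli_approx_measure.

(* All the measures involved live on the compact set [Ibeta beta], so testing
   against C(Ibeta beta), C_0(R) or, as here, bounded continuous functions on R
   gives the same notion of weak-star limit. *)
Definition is_bernoulli_convolution
    (nu : probability (measurableTypeR R) R) : Prop :=
  forall g : R -> R, continuous g -> bounded_fun g ->
    \int[bernoulli_approx n]_x (g x)%:E @[n --> \oo] --> \int[nu]_x (g x)%:E.

End bernoulli.

(* Main.v *)
From HB Require Import structures.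
Require Import Defs.
From mathcomp Require Import all_boot all_order all_algebra.
From mathcomp Require Import ring lra.
From mathcomp Require Import all_classical all_reals all_analysis.
From mathcomp Require Import measurable_realfun.

(** Write [I] for [Ibeta beta].  A word [a] of length [n] is a prefix of an
    expansion of [x] exactly when [x] lies in [partial_value beta a + beta^-n I],
    so [fn beta n] is the density of the [n]-th Bernoulli approximation smoothed
    at scale [beta^-n] by the uniform law on [I].  Splitting off the first digit
    gives [fn (n + 1) = transfer (fn n)], where
    [transfer f x = beta / 2 * (f (beta * x) + f (beta * x - 1))] preserves
    integrals and is the action on densities of the self-similarity of [nu].
    All the counting below is done through this recursion.

    If [0 < J < +oo]: the upper limit satisfies [fbar <= transfer fbar]
    ([fbar_le_transfer]) and both sides have the same finite integral, so they
    agree almost everywhere ([fbar_transfer_ae]).  Hence [fbar / J] is a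
    probability density on [I] fixed by [transfer].  There is only one such law:
    its distribution function and those of the approximations obey the same
    recursion, which shrinks their distance by a factor [beta] in the argument,
    and this forces it to be [nu] ([fixed_density_bernoulli]).

    If [nu] is absolutely continuous: all the values of the extensions of a
    prefix counted at [x] lie within [r = beta^-n / (beta - 1)] of [x], so
    [fn n x <= nu (B (x, r)) / r] ([fn_le_ball_ratio]).  By Lebesgue's
    differentiation theorem the right-hand side tends almost everywhere to twice
    the density of [nu], and by Tonelli its integral is exactly [2].  Therefore
    [J <= 2]; and Fatou's lemma applied to the nonnegative difference, whose
    integral is [2 - 1 = 1], gives [2 <= 1 + J] ([integral_fbar_bounds]).  So
    [1 <= J <= 2], the first part applies, and uniqueness of Radon-Nikodym
    derivatives identifies the density of [nu]. *)

Set Implicit Arguments.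
Unset Strict Implicit.
Unset Printing Implicit Defensive.

Import Order.TTheory GRing.Theory Num.Theory.
Import numFieldNormedType.Exports.

Local Open Scope classical_set_scope.
Local Open Scope ring_scope.

(** * Expansions and their prefixes *)

Lemma big_tuple_cons (T : Type) (idx : T) (op : Monoid.com_law idx)
    (S : finType) n (F : n.+1.-tuple S -> T) :
  \big[op/idx]_(a : n.+1.-tuple S) F a =
  \big[op/idx]_(d : S) \big[op/idx]_(a : n.-tuple S) F [tuple of d :: a].
Proof.
rewrite pair_big/=.
rewrite (reindex (fun p : S * n.-tuple S => [tuple of p.1 :: p.2]))//.
exists (fun a : n.+1.-tuple S => (thead a, [tuple of behead a])) => [[d a] _|a _] /=.
  by congr (_, _); apply: val_inj.
by rewrite -tuple_eta.
Qed.

Section digits.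
Context {R : realType}.
Variable beta : R.
Hypothesis beta_gt1 : 1 < beta.
Hypothesis beta_lt2 : beta < 2.
Implicit Types (x y : R) (n : nat) (s : nat -> bool).

Let beta_gt0 : 0 < beta. Proof. by rewrite (lt_trans _ beta_gt1). Qed.
Let beta_neq0 : beta != 0. Proof. by rewrite gt_eqF. Qed.
Let betaB1_gt0 : 0 < beta - 1. Proof. by rewrite subr_gt0. Qed.

Lemma betaVn_cvg0 : beta ^- n @[n --> \oo] --> (0 : R).
Proof.
under eq_fun do rewrite -exprVn.
apply: cvg_expr.
by rewrite ger0_norm ?invr_ge0 1?ltW// invf_lt1.
Qed.

(** The denominator-free form of membership, linear in [x], is the one that
    [lra] and [nra] can use. *)
Lemma mem_Ibeta x : (x \in Ibeta beta) = (0 <= x) && ((beta - 1) * x <= 1).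
Proof.
by rewrite /Ibeta mem_setE in_itv/= -[X in x <= X]mul1r ler_pdivlMr// mulrC.
Qed.

(** Dropping the first digit of an expansion follows the dynamics
    [x |-> beta * x - digit]; the recursion on prefix counts rests on it. *)
Lemma is_expansion_tail x s :
  is_expansion beta x s <->
  is_expansion beta (beta * x - (s 0%N)%:R) (fun k => s k.+1).
Proof.
rewrite /is_expansion.
pose u := series (fun k => (s k)%:R * beta ^- k.+1).
pose v := series (fun k => (s k.+1)%:R * beta ^- k.+1).
rewrite -/u -/v.
have uS n : u n.+1 = beta^-1 * ((s 0%N)%:R + v n).
  rewrite /u /v /series/= big_nat_recl// mulrDr expr1 mulrC; congr (_ + _).
  rewrite big_distrr/=; apply: eq_bigr => k _.
  by rewrite [in LHS]exprS invfM; ring.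
split=> [ux|vx].
- have -> : v = (fun n => beta * u n.+1 - (s 0%N)%:R).
    by apply/funext => n; rewrite uS mulrA mulfV// mul1r addrC addKr.
  apply: cvgB; last exact: cvg_cst.
  by apply: cvgMl_tmp; rewrite cvg_shiftS.
- rewrite -cvg_shiftS.
  have -> : [sequence u n.+1]_n = (fun n => beta^-1 * ((s 0%N)%:R + v n)).
    by apply/funext => n; rewrite -uS.
  have -> : x = beta^-1 * ((s 0%N)%:R + (beta * x - (s 0%N)%:R)).
    by rewrite [_ + (_ - _)]addrC subrK mulrA mulVf// mul1r.
  by apply: cvgMl_tmp; apply: cvgD => //; exact: cvg_cst.
Qed.

Lemma is_expansion_Ibeta x s : is_expansion beta x s -> x \in Ibeta beta.
Proof.
rewrite /is_expansion => sx; rewrite mem_Ibeta; apply/andP; split.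
  have <- := cvg_lim (@Rhausdorff R) sx.
  apply: limr_ge; first by apply/cvg_ex; exists x.
  apply: nearW => n; apply: sumr_ge0 => k _.
  by rewrite mulr_ge0// invr_ge0 exprn_ge0// ltW.
have sx' := @cvgMl_tmp _ _ _ eventually_filter _ (beta - 1) _ sx.
have <- := cvg_lim (@Rhausdorff R) sx'.
apply: limr_le; first by apply/cvg_ex; eexists; exact: sx'.
apply: nearW => n; apply: (@le_trans _ _ (1 - beta ^- n)); last first.
  by rewrite gerBl invr_ge0 exprn_ge0// ltW.
elim: n => [|n IH]; first by rewrite /series/= big_geq// mulr0 expr0 invr1 subrr.
rewrite seriesSr mulrDr -lerBrDr (le_trans IH)// lerBrDr.
have bn : beta ^- n = beta * beta ^- n.+1 by rewrite exprS invfM mulrA mulfV ?mul1r.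
rewrite bn; have : 0 < beta ^- n.+1 by rewrite invr_gt0 exprn_gt0.
move: betaB1_gt0.
case: (s n) => /=; set b := beta ^- n.+1; nra.
Qed.

(** The greedy algorithm: take the digit [1] whenever [1 <= beta * y].  The orbit
    [y] stays in [Ibeta beta] because [beta < 2], and the error after [n] digits is
    [beta^-n * y n], which tends to [0]. *)
Lemma Ibeta_expansion x : x \in Ibeta beta -> exists s, is_expansion beta x s.
Proof.
move=> xI.
pose y := fix y k := if k is k'.+1 then beta * y k' - (1 <= beta * y k')%R%:R else x.
have yI k : y k \in Ibeta beta.
  elim: k => //= k; rewrite !mem_Ibeta.
  move: (y k) => {xI} z /andP[y0 yL].
  have [by1|by1] := leP 1 (beta * z) => /=.
    by rewrite subr_ge0 by1/=; move: (ler_wpM2l (ltW beta_gt0) yL); lra.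
  rewrite subr0 mulr_ge0// ?ltW//=.
  by move: (ler_wpM2l (ltW betaB1_gt0) (ltW by1)) beta_lt2; lra.
exists (fun k => 1 <= beta * y k)%R; rewrite /is_expansion.
set u := series _.
have xE n : u n = x - beta ^- n * y n.
  elim: n => [|n IH]; first by rewrite /u /series/= big_geq// expr0 invr1 mul1r subrr.
  rewrite /u seriesSr -/u IH /= mulrBr exprS invfM.
  by field; rewrite expf_neq0.
have -> : u = (fun n => x - beta ^- n * y n) by apply/funext.
rewrite -[X in _ --> X]subr0; apply: cvgB; first exact: cvg_cst.
have h := @cvgMr_tmp _ _ _ eventually_filter _ _ (beta - 1)^-1 betaVn_cvg0.
rewrite mul0r in h.
apply: (squeeze_cvgr _ (@cvg_cst _ 0 _ \oo _) h).
apply: nearW => n; have := yI n; rewrite /Ibeta mem_setE in_itv/= => /andP[y0 y1].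
have bn : 0 <= beta ^- n by rewrite invr_ge0 exprn_ge0// ltW.
by rewrite mulr_ge0//= ler_wpM2l.
Qed.

Lemma partial_value_cons n d (a : n.-tuple bool) :
  partial_value beta [tuple of d :: a] = beta^-1 * (d%:R + partial_value beta a).
Proof.
rewrite /partial_value big_ord_recl mulrDr tnth0 expr1 mulrC; congr (_ + _).
rewrite big_distrr/=; apply: eq_bigr => i _.
by rewrite tnthS [in LHS]exprS invfM; ring.
Qed.

Lemma nb_prefixes_sum n x :
  nb_prefixes n beta x = (\sum_(a : n.-tuple bool)
    `[< exists s : nat -> bool,
      (forall i : 'I_n, s i = tnth a i) /\ is_expansion beta x s >])%N.
Proof.
rewrite /nb_prefixes -sum1_card [RHS](eq_bigr
  (fun a => if a \in expansion_prefixes n beta x then 1 else 0)%N).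
  by rewrite big_mkcond.
by move=> a _; rewrite inE; case: (asbool _).
Qed.

(** The empty word is a prefix as soon as one expansion exists, whence the two
    inclusions between [Ibeta beta] and the set of expandable points. *)
Lemma nb_prefixes0 x : nb_prefixes 0 beta x = (x \in Ibeta beta).
Proof.
rewrite nb_prefixes_sum (bigD1 [tuple])//= big1 ?addn0; last first.
  by move=> a; rewrite tuple0.
congr nat_of_bool; apply/asboolP/idP => [[s [_ /is_expansion_Ibeta//]]|].
by move=> /Ibeta_expansion[s xs]; exists s; split=> // -[].
Qed.

Lemma nb_prefixes_first_digit n x : nb_prefixes n.+1 beta x =
  (nb_prefixes n beta (beta * x) + nb_prefixes n beta (beta * x - 1))%N.
Proof.
rewrite !nb_prefixes_sum big_tuple_cons big_bool/= addnC.
have H (d : bool) : (\sum_(a : n.-tuple bool)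
    `[< exists s : nat -> bool,
      (forall i : 'I_n, s i = tnth a i) /\ is_expansion beta (beta * x - d%:R) s >])%N
  = (\sum_(a : n.-tuple bool)
    `[< exists s : nat -> bool,
      (forall i : 'I_n.+1, s i = tnth [tuple of d :: a] i) /\ is_expansion beta x s >])%N.
  apply: eq_bigr => a _; congr nat_of_bool; apply/asboolP/asboolP.
    move=> [s [sa xs]]; exists (fun k => if k is k'.+1 then s k' else d); split.
      by move=> i; case: (unliftP ord0 i) => [j|] ->//=; rewrite tnthS sa.
    exact/is_expansion_tail.
  move=> [s [sa /is_expansion_tail xs]].
  have s0 : s 0%N = d by rewrite (sa ord0) tnth0.
  exists (fun k => s k.+1); rewrite -s0; split=> // i.
  by rewrite -(tnthS d a) -sa.
by rewrite -!H subr0.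
Qed.

Lemma nb_prefixes_out n x : x \notin Ibeta beta -> nb_prefixes n beta x = 0%N.
Proof.
move=> xI; rewrite nb_prefixes_sum big1// => a _.
case: asboolP => // -[s [_ /is_expansion_Ibeta]].
by rewrite (negbTE xI).
Qed.

End digits.

(** * Affine changes of variables and the transfer operator *)

Section affine_change_of_variables.
Context {R : realType}.
Local Notation lam := (@lebesgue_measure R).
Local Open Scope ereal_scope.
Variables (b d : R).
Hypothesis b_gt0 : (0 < b)%R.

Let phi (x : measurableTypeR R) : measurableTypeR R := (b * x - d)%R.

Let measurable_phi : measurable_fun setT phi.
Proof. by apply: measurable_funB => //; exact: mulrl_measurable. Qed.

HB.instance Definition _ := isMeasurableFun.Build _ _ _ _ phi measurable_phi.

Let b_nng : {nonneg R} := NngNum (ltW b_gt0).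

(** Both sides are measures, so it suffices to compare them on half-open
    intervals, where this is the scaling of lengths. *)
Lemma lebesgue_measure_affine (A : set (measurableTypeR R)) : measurable A ->
  lam A = b%:E * lam ((fun x => b * x - d)%R @^-1` A).
Proof.
apply: (@lebesgue_measure_unique R (mscale b_nng (pushforward lam phi))) => _ [[u v] _ <-].
rewrite [RHS](_ : _ = b%:E * lam [set` `]((u + d) / b)%R, ((v + d) / b)%R]]); last first.
  rewrite /mscale/= /pushforward; congr (_ * lam _).
  apply/seteqP; split=> x /=; rewrite !in_itv/= ltr_pdivrMr// ler_pdivlMr// /phi;
  by rewrite ltrBrDr lerBlDr [(x * b)%R]mulrC.
rewrite !lebesgue_measure_itv/= !lte_fin ltr_pM2r ?invr_gt0// ltrD2r.
case: ifPn => _; last by rewrite mule0.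
rewrite -!EFinB -EFinM; congr EFin; field.
by rewrite gt_eqF.
Qed.

Lemma ge0_integral_affine (D : set (measurableTypeR R)) (f : R -> \bar R) :
  measurable D -> measurable_fun D f -> (forall x, 0 <= f x) ->
  \int[lam]_(x in D) f x =
  b%:E * \int[lam]_(x in (fun x => b * x - d)%R @^-1` D) f (b * x - d)%R.
Proof.
move=> mD mf f0.
rewrite -(@ge0_integral_pushforward _ _ _ _ _ phi measurable_phi lam D f)//.
rewrite -[in RHS](@ge0_integral_mscale _ _ _ (pushforward lam phi) D mD b_nng f mf)//.
apply: eq_measure_integral => A mA _.
exact: lebesgue_measure_affine.
Qed.

End affine_change_of_variables.

Section transfer.
Context {R : realType}.
Local Notation lam := (@lebesgue_measure R).
Local Open Scope ereal_scope.
Variable beta : R.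
Hypothesis beta_gt1 : (1 < beta)%R.
Let beta_gt0 : (0 < beta)%R. Proof. by rewrite (lt_trans _ beta_gt1). Qed.

(** If [f] is the density of [Y] and [d] is a fair digit independent of [Y], then
    [transfer beta f] is the density of [(d + Y) / beta]. *)
Definition transfer (f : R -> \bar R) (x : R) : \bar R :=
  (beta / 2)%:E * (f (beta * x)%R + f (beta * x - 1)%R).

Lemma transfer_ge0 f : (forall x, 0 <= f x) -> forall x, 0 <= transfer f x.
Proof. by move=> f0 x; rewrite mule_ge0 ?adde_ge0// lee_fin divr_ge0// ltW. Qed.

Lemma measurable_transfer f :
  measurable_fun setT f -> measurable_fun setT (transfer f).
Proof.
move=> mf; apply: emeasurable_funM => //; apply: emeasurable_funD.
  by apply: measurableT_comp => //; exact: mulrl_measurable.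
by apply: measurableT_comp => //; apply: measurable_funB => //.
Qed.

(** [D] is the common preimage of [D0] and [D1] under the two branches; keeping the
    three sets apart allows the same lemma to serve for rays and for the line. *)
Lemma integral_transfer f (D D0 D1 : set R) :
  measurable_fun setT f -> (forall x, 0 <= f x) ->
  measurable D0 -> measurable D1 ->
  (forall x, D x <-> D0 (beta * x)%R) -> (forall x, D x <-> D1 (beta * x - 1)%R) ->
  \int[lam]_(x in D) transfer f x =
  (2^-1)%:E * (\int[lam]_(x in D0) f x + \int[lam]_(x in D1) f x).
Proof.
move=> mf f0 mD0 mD1 DD0 DD1.
have m0 : measurable_fun setT (fun x => f (beta * x)%R).
  by apply: measurableT_comp => //; exact: mulrl_measurable.
have m1 : measurable_fun setT (fun x => f (beta * x - 1)%R).
  by apply: measurableT_comp => //; apply: measurable_funB => //; exact: mulrl_measurable.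
have DE0 : (fun x => beta * x - 0)%R @^-1` D0 = D.
  by apply/seteqP; split=> x /=; rewrite subr0 => /DD0.
have DE1 : (fun x => beta * x - 1)%R @^-1` D1 = D.
  by apply/seteqP; split=> x /= /DD1.
have mD : measurable D.
  rewrite -DE1 -[X in measurable X]setTI.
  by apply: (measurable_funB (mulrl_measurable beta) (measurable_cst (1 : R)%R)).
rewrite /transfer ge0_integralZl//; last 3 first.
  by apply: measurable_funTS; exact: emeasurable_funD.
  by move=> x _; rewrite adde_ge0.
  by rewrite lee_fin divr_ge0// ltW.
rewrite ge0_integralD//; [|exact: measurable_funTS..].
rewrite (@ge0_integral_affine _ _ 0 beta_gt0 D0)//; last exact: measurable_funTS.
rewrite (@ge0_integral_affine _ _ 1 beta_gt0 D1)//; last exact: measurable_funTS.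
rewrite DE0 DE1; under [in RHS]eq_integral do rewrite subr0.
rewrite -ge0_muleDr ?integral_ge0// muleA -EFinM; congr (_ * _).
by rewrite mulrC.
Qed.

Lemma integral_transferT f :
  measurable_fun setT f -> (forall x, 0 <= f x) ->
  \int[lam]_x transfer f x = \int[lam]_x f x.
Proof.
move=> mf f0; transitivity ((2^-1)%:E * (\int[lam]_x f x + \int[lam]_x f x)).
  exact: (@integral_transfer f setT setT setT).
have := integral_ge0 lam (D := setT) (fun x _ => f0 x).
case: (\int[lam]_x f x) => [r _| _|//].
  by rewrite -EFinD -EFinM; congr EFin; field.
by rewrite addye// gt0_muley// lte_fin invr_gt0.
Qed.

End transfer.

(** * Upper limits and the counting functions *)

Section ae_eq_of_le.
Local Open Scope ereal_scope.
Context d (T : measurableType d) (R : realType) (mu : {measure set T -> \bar R}).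

(** The inequalities between integrals over a set and over its complement add up
    to an equality of finite numbers, so each of them is an equality. *)
Lemma ge0_le_ae_eq (f g : T -> \bar R) :
  measurable_fun setT f -> measurable_fun setT g ->
  (forall x, 0 <= f x) -> (forall x, f x <= g x) ->
  \int[mu]_x f x < +oo -> \int[mu]_x g x <= \int[mu]_x f x ->
  ae_eq mu setT f g.
Proof.
move=> mf mg f0 fg fy gf.
have g0 x : 0 <= g x by rewrite (le_trans (f0 x)).
have le_on A : measurable A -> \int[mu]_(x in A) f x <= \int[mu]_(x in A) g x.
  by move=> mA; apply: ge0_le_integral => //; exact: measurable_funTS.
apply: integral_ae_eq => //.
  apply/integrableP; split=> //.
  by under eq_integral do rewrite gee0_abs//.
move=> E _ mE; apply/eqP; rewrite eq_le le_on//=.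
have mEC := measurableC mE.
have EEC : [disjoint E & ~` E] by rewrite disj_set2E setICr.
have fE : \int[mu]_x f x = \int[mu]_(x in E) f x + \int[mu]_(x in ~` E) f x.
  by rewrite -ge0_integral_setU// ?setUv.
have gE : \int[mu]_x g x = \int[mu]_(x in E) g x + \int[mu]_(x in ~` E) g x.
  by rewrite -ge0_integral_setU// ?setUv.
have gy A : measurable A -> \int[mu]_(x in A) g x \is a fin_num.
  move=> mA; rewrite ge0_fin_numE ?integral_ge0// (le_lt_trans _ (le_lt_trans gf fy))//.
  exact: ge0_subset_integral.
rewrite -(@leeD2rE _ (\int[mu]_(x in ~` E) g x))// ?gy//.
by rewrite -gE (le_trans gf)// fE leeD2l// le_on.
Qed.

End ae_eq_of_le.

Section limsup.
Local Open Scope ereal_scope.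
Context {R : realType}.
Implicit Types u v w : (\bar R)^nat.

Lemma limn_esup_ge0 u : (forall n, 0 <= u n) -> 0 <= limn_esup u.
Proof.
move=> u0; rewrite limn_esup_lim; apply: lime_ge; first exact: is_cvg_esups.
apply: nearW => n; apply: (le_trans (u0 n)).
by apply: ereal_sup_ubound; exists n => /=.
Qed.

Lemma le_limn_esup u v : (forall n, u n <= v n) -> limn_esup u <= limn_esup v.
Proof.
move=> uv; rewrite !limn_esup_lim.
apply: lee_lim; [exact: is_cvg_esups..|]; apply: nearW => n.
apply: ge_ereal_sup => _ [k /= nk <-]; apply: (le_trans (uv k)).
by apply: ereal_sup_ubound; exists k.
Qed.

(** Subadditivity of the upper limit along a recursion: the shift of the index is
    the one of [fn_transfer], where [w] at rank [n + 1] is given by [u] and [v] at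
    rank [n]. *)
Lemma limn_esup_leD_shift (c : R) u v w : (0 <= c)%R ->
  (forall n, 0 <= u n) -> (forall n, 0 <= v n) ->
  (forall n, w n.+1 <= c%:E * (u n + v n)) ->
  limn_esup w <= c%:E * (limn_esup u + limn_esup v).
Proof.
move=> c0 u0 v0 wuv; have := limn_esup_ge0 u0; have := limn_esup_ge0 v0.
rewrite !limn_esup_lim => lv0 lu0.
have cw : esups w n.+1 @[n --> \oo] --> limn (esups w).
  by rewrite (cvg_shiftS (esups w)); exact: is_cvg_esups.
have cuv : c%:E * (esups u n + esups v n) @[n --> \oo] -->
    c%:E * (limn (esups u) + limn (esups v)).
  apply: cvgeZl => //; apply: cvgeD; [|exact: is_cvg_esups..].
  exact: ge0_adde_def.
rewrite -(cvg_lim _ cw)// -(cvg_lim _ cuv)//.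
apply: lee_lim; [by apply/cvg_ex; eexists; exact: cw| |].
  by apply/cvg_ex; eexists; exact: cuv.
apply: nearW => n; apply: ge_ereal_sup => _ [[//|k] /= nk <-].
apply: (le_trans (wuv k)); rewrite lee_wpmul2l ?lee_fin//.
by apply: leeD; apply: ereal_sup_ubound; exists k.
Qed.

End limsup.

Section normalized_counting.
Context {R : realType}.
Local Notation lam := (@lebesgue_measure R).
Local Open Scope ereal_scope.
Variable beta : R.
Hypothesis beta_gt1 : (1 < beta)%R.
Hypothesis beta_lt2 : (beta < 2)%R.
Let beta_gt0 : (0 < beta)%R. Proof. by rewrite (lt_trans _ beta_gt1). Qed.
Let betaB1_gt0 : (0 < beta - 1)%R. Proof. by rewrite subr_gt0. Qed.

Lemma fn_ge0 n x : (0 <= fn beta n x)%R.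
Proof.
by rewrite /fn !mulr_ge0 ?invr_ge0 ?exprn_ge0// ltW.
Qed.

Lemma fn0 x : fn beta 0 x = ((beta - 1) * \1_(Ibeta beta) x)%R.
Proof. by rewrite /fn !expr0 nb_prefixes0// invr1 !mulr1 indicE. Qed.

Lemma fn_transfer n x :
  (fn beta n.+1 x)%:E = transfer beta (fun y => (fn beta n y)%:E) x.
Proof.
rewrite /transfer -EFinD -EFinM; congr EFin.
rewrite /fn nb_prefixes_first_digit// natrD !exprS.
by field; rewrite expf_neq0.
Qed.

Lemma fn_out n x : x \notin Ibeta beta -> fn beta n x = 0%R.
Proof. by move=> xI; rewrite /fn nb_prefixes_out// mulr0. Qed.

Lemma measurable_fn n : measurable_fun setT (fun x => (fn beta n x)%:E).
Proof.
elim: n => [|n IH].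
  under eq_fun do rewrite fn0//.
  apply/measurable_EFinP; apply: measurable_funM => //; apply: measurable_indic.
  exact: measurable_itv.
have -> : (fun x => (fn beta n.+1 x)%:E) =
    transfer beta (fun x => (fn beta n x)%:E).
  by apply/funext => x; exact: fn_transfer.
exact: measurable_transfer.
Qed.

(** [fn beta 0] is the uniform density on [Ibeta beta], and [transfer] preserves
    integrals. *)
Lemma integral_fn n : \int[lam]_x (fn beta n x)%:E = 1.
Proof.
have fn0E n' x : 0 <= (fn beta n' x)%:E by rewrite lee_fin fn_ge0.
elim: n => [|n IH].
  under eq_integral do rewrite fn0// EFinM.
  rewrite ge0_integralZl//; last 2 first.
    by apply/measurable_EFinP; apply: measurable_indic; exact: measurable_itv.
    by rewrite lee_fin ltW.
  rewrite integral_indic//=; last exact: measurable_itv.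
  rewrite setIT lebesgue_measure_itv/= lte_fin invr_gt0 betaB1_gt0.
  by rewrite -EFinB -EFinM subr0 mulfV// gt_eqF.
have -> : (fun x => (fn beta n.+1 x)%:E) =
    transfer beta (fun x => (fn beta n x)%:E).
  by apply/funext => x; exact: fn_transfer.
by rewrite integral_transferT//; exact: measurable_fn.
Qed.

Lemma fbar_ge0 x : 0 <= fbar beta x.
Proof. by apply: limn_esup_ge0 => n; rewrite lee_fin fn_ge0. Qed.

Lemma fbar_out x : x \notin Ibeta beta -> fbar beta x = 0.
Proof.
move=> xI; rewrite /fbar.
under [X in limn_esup X]eq_fun do rewrite fn_out//.
by rewrite (cvg_limn_einf_sup (cvg_cst (0 : \bar R))).2.
Qed.

Lemma measurable_fbar : measurable_fun setT (fbar beta).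
Proof.
by apply: measurable_fun_limn_esup => n; exact: measurable_fn.
Qed.

Lemma integral_fbarT :
  \int[lam]_(x in Ibeta beta) fbar beta x = \int[lam]_x fbar beta x.
Proof.
rewrite integral_mkcond; apply: eq_integral => x _.
by rewrite patchE; case: ifPn => // /fbar_out ->.
Qed.

(** Only an inequality: the upper limit of a sum may be smaller than the sum of
    the upper limits. *)
Lemma fbar_le_transfer x : fbar beta x <= transfer beta (fbar beta) x.
Proof.
apply: limn_esup_leD_shift; first by rewrite divr_ge0// ltW.
- by move=> n; rewrite lee_fin fn_ge0.
- by move=> n; rewrite lee_fin fn_ge0.
- by move=> n; rewrite fn_transfer.
Qed.

(** Both sides of [fbar_le_transfer] have the same integral; finiteness of this
    integral rules out that they differ on a set of positive measure. *)
Lemma fbar_transfer_ae : \int[lam]_x fbar beta x < +oo ->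
  ae_eq lam setT (fbar beta) (transfer beta (fbar beta)).
Proof.
move=> fy; apply: ge0_le_ae_eq => //.
- exact: measurable_fbar.
- by apply: measurable_transfer; exact: measurable_fbar.
- exact: fbar_ge0.
- exact: fbar_le_transfer.
rewrite integral_transferT//; [exact: measurable_fbar|exact: fbar_ge0].
Qed.

End normalized_counting.

(** * Finite measures on the line *)

Section finite_measures_on_line.
Local Open Scope ereal_scope.
Context {R : realType}.
Implicit Types m : {measure set (measurableTypeR R) -> \bar R}.

Lemma measurable_sublevel (phi : R -> R) (r : R) : continuous phi ->
  measurable [set x | (phi x <= r)%R].
Proof.
move=> /continuous_measurable_fun mphi.
rewrite -[X in measurable X]setTI (_ : [set x | _] = phi @^-1` `]-oo, r]).
  by apply: mphi => //; exact: measurable_itv.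
by apply/seteqP; split=> x /=; rewrite in_itv.
Qed.

(** Continuity from above.  Closed sets enter as sublevel sets of continuous
    functions, which makes their closed neighbourhoods sublevel sets too. *)
Lemma sublevel_limit m (phi : R -> R) (c : \bar R) : m setT < +oo ->
  continuous phi ->
  (forall e : R, (0 < e)%R -> c <= m [set x | (phi x <= e)%R]) ->
  c <= m [set x | (phi x <= 0)%R].
Proof.
move=> my cphi ce; pose F n := [set x | (phi x <= n.+1%:R^-1)%R].
have FE : [set x | (phi x <= 0)%R] = \bigcap_n F n.
  apply/seteqP; split=> x /= => [x0 n _|xF]; first exact: (le_trans x0).
  apply/ler_addgt0Pr => e e0; rewrite add0r.
  have [n ne] : exists n, (n.+1%:R^-1 <= e)%R.
    exists (Num.truncn e^-1); rewrite invf_ple ?posrE//.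
    exact/ltW/truncnS_gt.
  by apply: le_trans ne; exact: xF.
have mF n : measurable (F n) by exact: measurable_sublevel.
have cF : m \o F @ \oo --> m (\bigcap_n F n).
  apply: nonincreasing_cvg_mu => //.
  - apply: le_lt_trans my; apply: le_measure; rewrite ?inE//; exact: mF.
  - exact: bigcapT_measurable.
  - move=> i j ij; apply/subsetPset => x /= /le_trans; apply.
    by rewrite lef_pV2 ?posrE// ler_nat.
rewrite FE; apply: (cvge_ge _ cF); apply: nearW => n.
by apply: ce; rewrite invr_gt0.
Qed.

(** Equality on rays gives equality on half-open intervals, which are stable under
    intersection and generate the Borel sets. *)
Lemma measure_eq_rays m m' : m' setT < +oo ->
  (forall t : R, m `]-oo, t]%classic = m' `]-oo, t]%classic) ->
  forall A, measurable A -> m A = m' A.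
Proof.
move=> m'y mm' A mA.
have m'fin B : measurable B -> m' B < +oo.
  by move=> mB; apply: le_lt_trans m'y; apply: le_measure; rewrite ?inE.
have oc (a b : R) : (a <= b)%R -> `]a, b]%classic = `]-oo, b]%classic `\` `]-oo, a]%classic.
  move=> ab; apply/seteqP; split=> x /=; rewrite !in_itv/=.
    by move=> /andP[ax xb]; split=> //; apply/negP; rewrite -ltNge.
  by move=> [xb /negP]; rewrite -ltNge => ->.
have mocE (a b : R) : m `]a, b]%classic = m' `]a, b]%classic.
  have [ab|ba] := leP a b; last by rewrite set_itv_ge ?measure0// bnd_simp -leNgt ltW.
  have sub : `]-oo, b]%classic `&` `]-oo, a]%classic = `]-oo, a]%classic.
    apply/setIidr => x /=; rewrite !in_itv/= => xa; exact: le_trans ab.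
  rewrite oc// !measureD//; last 2 first.
  - by apply: m'fin; exact: measurable_itv.
  - by have := m'fin `]-oo, b]%classic (measurable_itv _); rewrite -mm'.
  by rewrite !sub; congr (_ - _); exact: mm'.
apply: (@measure_unique _ R (measurableTypeR R) (@ocitv R)
    (fun n => `](- n%:R)%R, n%:R]%classic) _ _ _ _ m m' _ _ A mA) => //.
- exact: ocitvI.
- by move=> n; exists (- n%:R, n%:R)%R.
- exact: bigcup_itvT.
- by move=> _ [[a b] _ <-].
- by move=> n /=; rewrite mocE; apply: m'fin; exact: measurable_itv.
Qed.

End finite_measures_on_line.

Section density_measure.
Local Open Scope ereal_scope.
Context d (T : measurableType d) (R : realType) (mu : {measure set T -> \bar R}).
Variable f : T -> \bar R.
Hypothesis mf : measurable_fun setT f.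
Hypothesis f_ge0 : forall x, 0 <= f x.

Definition density_measure (A : set T) : \bar R := \int[mu]_(x in A) f x.

Let density_measure0 : density_measure set0 = 0.
Proof. exact: integral_set0. Qed.

Let density_measure_ge0 A : 0 <= density_measure A.
Proof. exact: integral_ge0. Qed.

Let density_measure_semi_sigma_additive : semi_sigma_additive density_measure.
Proof.
move=> F mF tF mUF; rewrite /density_measure ge0_integral_bigcup//.
  apply: is_cvg_ereal_nneg_natsum => n _; exact: integral_ge0.
exact: measurable_funTS.
Qed.

HB.instance Definition _ := isMeasure.Build _ _ _ density_measure
  density_measure0 density_measure_ge0 density_measure_semi_sigma_additive.

(** Lets the density be used as a measure without carrying the proofs of its
    measurability and nonnegativity. *)
Lemma density_measure_exists : exists m : {measure set T -> \bar R},
  forall A, m A = \int[mu]_(x in A) f x.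
Proof. by exists density_measure. Qed.

End density_measure.

(** * Bernoulli approximations and weak limits *)

Section bernoulli_approximations.
Local Open Scope ereal_scope.
Context {R : realType}.
Variable beta : R.
Hypothesis beta_gt1 : (1 < beta)%R.
Let beta_gt0 : (0 < beta)%R. Proof. by rewrite (lt_trans _ beta_gt1). Qed.
Let betaB1_gt0 : (0 < beta - 1)%R. Proof. by rewrite subr_gt0. Qed.
Implicit Types A : set (measurableTypeR R).

Lemma bernoulli_approx0E A : bernoulli_approx beta 0 A = \d_(0%R : R) A.
Proof.
rewrite /bernoulli_approx expr0 invr1 mul1e (bigD1 [tuple])//= big1 ?adde0.
  by rewrite /partial_value big_ord0.
by move=> a; rewrite tuple0.
Qed.

(** The self-similarity of [nu] at a finite level; the preimages are those of the
    branches [y |-> (d + y) / beta], [d = 0, 1]. *)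
Lemma bernoulli_approx_first_digit n A : bernoulli_approx beta n.+1 A =
  (2^-1)%:E * (bernoulli_approx beta n ((fun y => beta^-1 * y)%R @^-1` A) +
               bernoulli_approx beta n ((fun y => beta^-1 * (1 + y))%R @^-1` A)).
Proof.
rewrite /bernoulli_approx big_tuple_cons big_bool/= addeC.
rewrite -ge0_muleDr ?sume_ge0// muleA -EFinM exprS invfM.
congr (_ * (_ + _)); apply: eq_bigr => a _.
  by rewrite !diracE partial_value_cons//; congr (_%:R%:E); rewrite add0r.
by rewrite !diracE partial_value_cons.
Qed.

(** The two maps [y |-> (d + y) / beta] send [Ibeta beta] into itself. *)
Lemma bernoulli_approx_supp n A : Ibeta beta `<=` A -> bernoulli_approx beta n A = 1.
Proof.
elim: n A => [|n IH] A IA.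
  rewrite bernoulli_approx0E diracE mem_set//; apply: IA.
  by rewrite /Ibeta /= in_itv/= lexx invr_ge0 ltW.
have stable (d : bool) : Ibeta beta `<=` (fun y => beta^-1 * (d%:R + y))%R @^-1` A.
  move=> y yI; apply: IA; apply: set_mem; move/mem_set: yI.
  rewrite !mem_Ibeta// => /andP[y0 y1].
  have -> /= : (0 <= beta^-1 * (d%:R + y))%R.
    by apply: mulr_ge0; [rewrite invr_ge0 ltW|exact: addr_ge0].
  rewrite mulrCA ler_pdivrMl// mulr1.
  by case: d => /=; move: y1 betaB1_gt0; lra.
rewrite bernoulli_approx_first_digit (IH _ (stable true)) IH.
  by rewrite -EFinD -EFinM; congr EFin; field.
by move=> y /(stable false) /=; rewrite add0r.
Qed.

Lemma bernoulli_approx_rayS n (t : R) :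
  bernoulli_approx beta n.+1 `]-oo, t]%classic =
  (2^-1)%:E * (bernoulli_approx beta n `]-oo, (beta * t)%R]%classic +
               bernoulli_approx beta n `]-oo, (beta * t - 1)%R]%classic).
Proof.
rewrite bernoulli_approx_first_digit.
congr (_ * (bernoulli_approx _ _ _ + bernoulli_approx _ _ _)).
  by apply/seteqP; split=> y /=; rewrite !in_itv/= ler_pdivrMl.
by apply/seteqP; split=> y /=; rewrite !in_itv/= ler_pdivrMl// lerBrDl.
Qed.

End bernoulli_approximations.

Section weak_limit.
Local Open Scope ereal_scope.
Context {R : realType}.
Variable beta : R.
Variable nu : probability (measurableTypeR R) R.
Hypothesis nu_beta : is_bernoulli_convolution beta nu.

(** A continuous function squeezed between the indicators of [phi <= 0] and of
    [phi <= e]; it turns weak convergence into inequalities between measures of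
    sets. *)
Definition cutoff (phi : R -> R) (e : R) (x : R) : R :=
  Num.max 0%R (Num.min 1%R (1 - phi x / e))%R.

Lemma cutoff_continuous phi e : continuous phi -> continuous (cutoff phi e).
Proof.
move=> cphi x; rewrite /cutoff.
apply: (@continuous_max _ _ (fun=> 0%R) (fun y => Num.min 1%R (1 - phi y / e)%R)).
  exact: cvg_cst.
apply: (@continuous_min _ _ (fun=> 1%R) (fun y => (1 - phi y / e)%R)).
  exact: cvg_cst.
apply: cvgB; first exact: cvg_cst.
by apply: cvgMr_tmp; exact: cphi.
Qed.

Lemma cutoff_ge0 phi e x : (0 <= cutoff phi e x)%R.
Proof. by rewrite /cutoff le_max lexx. Qed.

Lemma cutoff_le1 phi e x : (cutoff phi e x <= 1)%R.
Proof. by rewrite /cutoff ge_max ler01/= ge_min lexx. Qed.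

Lemma cutoff_integral (m : {measure set (measurableTypeR R) -> \bar R})
    (phi : R -> R) (e : R) : (0 < e)%R -> continuous phi ->
  m [set x | (phi x <= 0)%R] <= \int[m]_x (cutoff phi e x)%:E
    <= m [set x | (phi x <= e)%R].
Proof.
move=> e0 cphi; have mcut : measurable_fun setT (fun x => (cutoff phi e x)%:E).
  by apply/measurable_EFinP; apply: continuous_measurable_fun; exact: cutoff_continuous.
have mS r := measurable_sublevel r cphi.
have indE r : m [set x | (phi x <= r)%R] =
    \int[m]_x (\1_[set x | (phi x <= r)%R] x)%:E.
  by rewrite integral_indic ?setIT//; exact: (mS r).
rewrite !indE; apply/andP; split; apply: ge0_le_integral => //.
- by apply/measurable_EFinP; apply: measurable_indic; exact: mS.
- move=> x _; rewrite lee_fin indicE; case: (boolP (x \in _)) => [/set_mem/= phix|_] /=.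
    rewrite /cutoff le_max le_min lexx/= lerBrDr gerDl.
    by rewrite pmulr_lle0 ?invr_gt0// phix orbT.
  exact: cutoff_ge0.
- by move=> x _; rewrite lee_fin cutoff_ge0.
- by apply/measurable_EFinP; apply: measurable_indic; exact: mS.
- move=> x _; rewrite lee_fin indicE; case: (boolP (x \in _)) => [_|/negP phix] /=.
    exact: cutoff_le1.
  rewrite /cutoff ge_max lexx/= ge_min subr_le0 ler_pdivlMr// mul1r.
  rewrite [(e <= _)%R]ltW ?orbT// ltNge; apply/negP => phix'.
  by apply: phix; exact: mem_set.
Qed.

Lemma cvg_cutoff (phi : R -> R) (e : R) : continuous phi ->
  \int[bernoulli_approx beta n]_x (cutoff phi e x)%:E @[n --> \oo] -->
  \int[nu]_x (cutoff phi e x)%:E.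
Proof.
move=> cphi; apply: nu_beta; first exact: cutoff_continuous.
exists 1%R; split=> // M M1 x _ /=; rewrite (le_trans _ (ltW M1))//.
by rewrite ger0_norm ?cutoff_ge0 ?cutoff_le1.
Qed.

(** The closed-set half of the portmanteau theorem. *)
Lemma weak_limit_closed (phi : R -> R) (c : \bar R) : continuous phi ->
  (\forall n \near \oo, c <= bernoulli_approx beta n [set x | (phi x <= 0)%R]) ->
  c <= nu [set x | (phi x <= 0)%R].
Proof.
move=> cphi cn; apply: (sublevel_limit (m := nu)) => //.
  by rewrite (@le_lt_trans _ _ 1) ?ltry// probability_le1.
move=> e e0; have /andP[_] := cutoff_integral nu e0 cphi; apply: le_trans.
apply: (cvge_ge _ (cvg_cutoff (e := e) cphi)).
apply: filterS cn => n /le_trans; apply.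
by have /andP[] := cutoff_integral (bernoulli_approx beta n) e0 cphi.
Qed.

(** The opposite inequality holds only at the cost of enlarging the set on the side
    of the approximations. *)
Lemma weak_limit_upper (phi : R -> R) (e : R) (c : \bar R) : continuous phi ->
  (0 < e)%R ->
  (\forall n \near \oo, bernoulli_approx beta n [set x | (phi x <= e)%R] <= c) ->
  nu [set x | (phi x <= 0)%R] <= c.
Proof.
move=> cphi e0 cn.
have /andP[+ _] := cutoff_integral nu e0 cphi; move=> /le_trans; apply.
apply: (cvge_le _ (cvg_cutoff (e := e) cphi)).
apply: filterS cn => n; apply: le_trans.
by have /andP[] := cutoff_integral (bernoulli_approx beta n) e0 cphi.
Qed.

End weak_limit.

(** * Uniqueness of the self-similar density *)

Section fixed_densities.
Local Open Scope ereal_scope.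
Context {R : realType}.
Local Notation lam := (@lebesgue_measure R).
Variable beta : R.
Hypothesis beta_gt1 : (1 < beta)%R.
Let beta_gt0 : (0 < beta)%R. Proof. by rewrite (lt_trans _ beta_gt1). Qed.
Let betaB1_gt0 : (0 < beta - 1)%R. Proof. by rewrite subr_gt0. Qed.
Let L : R := (beta - 1)^-1%R.
Variable f : R -> \bar R.
Hypothesis mf : measurable_fun setT f.
Hypothesis f_ge0 : forall x, 0 <= f x.
Hypothesis f_out : forall x, x \notin Ibeta beta -> f x = 0.
Hypothesis f_int1 : \int[lam]_x f x = 1.
Hypothesis f_fixed : ae_eq lam setT f (transfer beta f).

Let F (t : R) : \bar R := \int[lam]_(x in `]-oo, t]) f x.

Let F_rec t : F t = (2^-1)%:E * (F (beta * t)%R + F (beta * t - 1)%R).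
Proof.
rewrite /F; transitivity (\int[lam]_(x in `]-oo, t]) transfer beta f x).
  apply: ge0_ae_eq_integral => //.
  - exact: measurable_funTS.
  - by apply: measurable_funTS; exact: measurable_transfer.
  - by move=> x _; exact: transfer_ge0.
  - exact: ae_eq_subset f_fixed.
apply: integral_transfer => //.
- by move=> x /=; rewrite !in_itv/= ler_pM2l.
- by move=> x /=; rewrite !in_itv/= lerD2r ler_pM2l.
Qed.

(** [F] and the distribution functions of the approximations obey the same
    first-digit recursion.  At level [0] the point mass at [0] is compared with a
    law carried by an interval of length [L], and each step divides the discrepancy
    in the argument by [beta]. *)
Lemma fixed_density_ray_bounds n (t : R) :
  bernoulli_approx beta n `]-oo, (t - beta ^- n * L)%R]%classic <= F t /\
  F t <= bernoulli_approx beta n `]-oo, t]%classic.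
Proof.
elim: n t => [|n IH] t; last first.
  have [lo0 hi0] := IH (beta * t)%R; have [lo1 hi1] := IH (beta * t - 1)%R.
  have shift : (beta * (t - beta ^- n.+1 * L) = beta * t - beta ^- n * L)%R.
    by rewrite exprS invfM mulrBr !mulrA mulfV ?gt_eqF// mul1r.
  rewrite !bernoulli_approx_rayS// shift F_rec addrAC.
  by split; rewrite lee_pmul2l//; apply: leeD.
rewrite expr0 invr1 mul1r !bernoulli_approx0E !diracE; split.
- case: (boolP (_ \in _)) => [|_]; last exact: integral_ge0.
  rewrite mem_setE in_itv/= subr_ge0 => Lt; rewrite -f_int1 le_eqVlt; apply/orP; left.
  apply/eqP; rewrite /F [RHS]integral_mkcond; apply: eq_integral => x _.
  rewrite patchE; case: ifPn => // xt; rewrite f_out//.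
  apply: contra xt; rewrite /Ibeta !mem_setE !in_itv/= => /andP[_].
  by move=> /le_trans; exact.
- case: (boolP (_ \in _)) => [_|].
    rewrite -f_int1; apply: ge0_subset_integral => //.
  rewrite mem_setE in_itv/= -ltNge => t0.
  rewrite le_eqVlt; apply/orP; left; apply/eqP; apply: integral0_eq => x /=.
  rewrite in_itv/= => xt; apply: f_out; rewrite /Ibeta mem_setE in_itv/= negb_and.
  by rewrite -ltNge (le_lt_trans xt t0).
Qed.

(** The bounds on rays squeeze the distribution function of [nu] and that of the
    law of density [f] to the same limit. *)
Lemma fixed_density_bernoulli (nu : probability (measurableTypeR R) R) :
  is_bernoulli_convolution beta nu ->
  forall A : set (measurableTypeR R), measurable A -> nu A = \int[lam]_(x in A) f x.
Proof.
move=> nu_beta; have [m mE] := density_measure_exists lam mf f_ge0.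
have contB (t : R) : continuous (fun x : R => x - t)%R.
  by move=> x; apply: cvgB => //; exact: cvg_cst.
have rayE (t e : R) : [set x : R | (x - t <= e)%R] = `]-oo, (t + e)%R]%classic.
  by apply/seteqP; split=> x /=; rewrite in_itv/= lerBlDl.
have rayE0 (t : R) : [set x : R | (x - t <= 0)%R] = `]-oo, t]%classic.
  by rewrite rayE addr0.
move=> A mA; rewrite -mE; apply: measure_eq_rays mA; first by rewrite mE f_int1 ltry.
move=> t; apply/eqP; rewrite eq_le; apply/andP; split.
- (* one half of [e] pays for the weak limit, the other for the error [beta^-n * L]
     of the bounds on rays *)
  rewrite -rayE0; apply: (sublevel_limit (m := m)) => //; first by rewrite mE f_int1 ltry.
  move=> e e0; have e20 : (0 < e / 2)%R by rewrite divr_gt0.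
  apply: (@weak_limit_upper _ beta nu nu_beta _ (e / 2)%R) => //.
  have /cvgrPdist_le/(_ (e / 2)%R e20) : (beta ^- n * L)%R @[n --> \oo] --> (0 * L)%R.
    by apply: cvgMr_tmp; exact: betaVn_cvg0.
  apply: filterS => n; rewrite mul0r sub0r normrN => nL.
  rewrite !rayE mE; apply: le_trans (fixed_density_ray_bounds n (t + e)%R).1.
  apply: le_measure; rewrite ?inE; [exact: measurable_itv..|].
  move=> x /=; rewrite !in_itv/= => /le_trans; apply.
  have := le_trans (ler_norm _) nL; lra.
- rewrite -rayE0; apply: (weak_limit_closed nu_beta) => //.
  apply: nearW => n; rewrite rayE0 mE.
  exact: (fixed_density_ray_bounds n t).2.
Qed.

End fixed_densities.

(** * Lower limits, balls and differentiation of measures *)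

Section liminf_sum.
Local Open Scope ereal_scope.
Context {R : realType}.

(** Mixed inequality: along indices where [u] nears its infimum over the tail,
    [v] is at most its supremum over the tail. *)
Lemma limn_einf_leD (u v : (\bar R)^nat) :
  (forall n, 0 <= u n) -> (forall n, 0 <= v n) ->
  limn_einf (fun n => u n + v n) <= limn_einf u + limn_esup v.
Proof.
move=> u0 v0; set w := fun n => u n + v n.
have einf0 n : 0 <= einfs u n by apply: le_ereal_inf_tmp => _ [k /= _ <-].
have esup0 n : 0 <= esups v n.
  by apply: (le_trans (v0 n)); apply: ereal_sup_ubound; exists n => /=.
have le_n n : einfs w n <= einfs u n + esups v n.
  have [vfin|] := boolP (esups v n \is a fin_num); last first.
    rewrite ge0_fin_numE// -leNgt leye_eq => /eqP ->.
    by rewrite addey ?leey// -ltNye (lt_le_trans _ (einf0 n)).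
  rewrite -leeBlDr//; apply: le_ereal_inf_tmp => _ [k /= nk <-].
  rewrite leeBlDr//; apply: (@le_trans _ _ (w k)).
    by apply: ereal_inf_lbound; exists k.
  by rewrite leeD2l//; apply: ereal_sup_ubound; exists k.
rewrite !limn_einf_lim limn_esup_lim.
have cuv : einfs u n + esups v n @[n --> \oo] -->
    limn (einfs u) + limn (esups v).
  apply: cvgeD; [|exact: is_cvg_einfs|exact: is_cvg_esups].
  apply: ge0_adde_def; rewrite inE.
    by apply: lime_ge; [exact: is_cvg_einfs|exact: nearW].
  by apply: lime_ge; [exact: is_cvg_esups|exact: nearW].
rewrite -(cvg_lim _ cuv)//; apply: lee_lim; [exact: is_cvg_einfs| |exact: nearW].
by apply/cvg_ex; eexists; exact: cuv.
Qed.

Lemma limn_einf_ge0 (u : (\bar R)^nat) : (forall n, 0 <= u n) -> 0 <= limn_einf u.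
Proof.
move=> u0; rewrite limn_einf_lim; apply: lime_ge; first exact: is_cvg_einfs.
by apply: nearW => n; apply: le_ereal_inf_tmp => _ [k /= _ <-].
Qed.

Lemma measurable_fun_limn_einf d (T : measurableType d) (u : (T -> \bar R)^nat) :
  (forall n, measurable_fun setT (u n)) ->
  measurable_fun setT (fun x => limn_einf (u ^~ x)).
Proof.
move=> mu; apply: measurableT_comp => //.
by apply: measurable_fun_limn_esup => n; exact: measurableT_comp.
Qed.

End liminf_sum.

Section closed_balls.
Local Open Scope ereal_scope.
Context {R : realType}.
Local Notation lam := (@lebesgue_measure R).
Implicit Types x r : R.

(** A closed ball written as the sublevel set to which weak convergence is
    applied. *)
Definition cball x r : set (measurableTypeR R) := [set y | (`|y - x| <= r)%R].

Lemma cballE x r : cball x r = `[(x - r)%R, (x + r)%R]%classic.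
Proof. by apply/seteqP; split=> y; rewrite /cball/= in_itv/= ler_distl. Qed.

Lemma measurable_cball x r : measurable (cball x r).
Proof. by rewrite cballE; exact: measurable_itv. Qed.

Lemma lebesgue_measure_cball x r : (0 < r)%R -> lam (cball x r) = (r *+ 2)%:E.
Proof.
move=> r0; rewrite cballE lebesgue_measure_itv/= lte_fin ltrD2l.
by rewrite gtrN// -EFinB; congr EFin; ring.
Qed.

Let strip r : set (measurableTypeR R * measurableTypeR R) :=
  [set p | (`|p.2 - p.1| <= r)%R].

Let measurable_strip r : measurable (strip r).
Proof.
have m : measurable_fun [set: measurableTypeR R * measurableTypeR R]
    (fun p => `|p.2 - p.1|%R : R).
  by apply: measurableT_comp => //; apply: measurable_funB.
rewrite -[strip r]setTI (_ : strip r = (fun p => `|p.2 - p.1|%R : R) @^-1` `]-oo, r]).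
  by apply: m => //; exact: measurable_itv.
by apply/seteqP; split=> p /=; rewrite in_itv.
Qed.

Let xsection_strip x r : xsection (strip r) x = cball x r.
Proof. by apply/seteqP; split=> y /=; rewrite /xsection/= mem_setE. Qed.

Let ysection_strip x r : ysection (strip r) x = cball x r.
Proof.
by apply/seteqP; split=> y; rewrite /ysection /cball /strip/= inE/= distrC.
Qed.

Variable nu : probability (measurableTypeR R) R.

Lemma measurable_fun_cball r : measurable_fun setT (fun x => nu (cball x r)).
Proof.
have := measurable_fun_xsection nu (measurable_strip r).
rewrite (_ : nu \o xsection (strip r) = (fun x => nu (cball x r)))//.
by apply/funext => x /=; rewrite xsection_strip.
Qed.

(** Tonelli on the strip [|y - x| <= r], whose sections in both directions are
    balls of radius [r]. *)
Lemma integral_measure_cball r : (0 < r)%R ->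
  \int[lam]_x nu (cball x r) = (r *+ 2)%:E.
Proof.
move=> r0; have := indic_fubini_tonelli lam nu (measurable_strip r).
rewrite indic_fubini_tonelli_FE// indic_fubini_tonelli_GE//.
have -> : nu \o xsection (strip r) = (fun x => nu (cball x r)).
  by apply/funext => x /=; rewrite xsection_strip.
have -> : lam \o ysection (strip r) = cst (r *+ 2)%:E.
  by apply/funext => x /=; rewrite ysection_strip lebesgue_measure_cball.
move=> ->; rewrite integral_cst// -[RHS]mule1; congr (_ * _).
exact: probability_setT.
Qed.

(** Lebesgue differentiation; the factor [2] appears because the ball is divided by
    its radius and not by its length. *)
Lemma density_cvg_cball (h : R -> R) (r_ : R^nat) :
  lam.-integrable setT (EFin \o h) ->
  (forall A : set (measurableTypeR R), measurable A ->
    nu A = \int[lam]_(x in A) (h x)%:E) ->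
  (forall n, (0 < r_ n)%R) -> r_ n @[n --> \oo] --> (0 : R)%R ->
  {ae lam, forall x, (r_ n)^-1%:E * nu (cball x (r_ n)) @[n --> \oo] -->
    (2 * h x)%:E}.
Proof.
move=> ih nuh r0 rcvg.
have lh : locally_integrable setT h by apply: open_integrable_locally => //; exact: openT.
have := lebesgue_differentiation lh.
apply: filter_app; first exact: (ae_filter_ringOfSetsType lam).
apply: aeW => /= x xh.
have r20 n : (0 < 2 * r_ n)%R by rewrite mulr_gt0.
have nice y : nicely_shrinking y (fun n => cball y (r_ n)).
  split; first by move=> n; exact: measurable_cball.
  (* open balls of twice the radius contain the closed ones, and have twice their
     length *)
  exists (2%R, fun n => PosNum (r20 n)); split => //=.
  - by rewrite -[X in _ --> X](mulr0 (2%R : R)); exact: cvgMl_tmp.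
  - move=> n z; rewrite /cball /ball/= distrC => /le_lt_trans; apply.
    by rewrite ltr_pMl// ltr1n.
  - move=> n; rewrite lebesgue_measure_cball// lebesgue_measure_ball; last exact: ltW.
    by rewrite -EFinM lee_fin -mulrnAr.
have D := nice_lebesgue_differentiation nice lh xh.
have D2 := cvgeZl (erefl _ : 2%:E \is a fin_num) D.
rewrite EFinM; apply: cvg_trans D2; apply: near_eq_cvg; apply: nearW => n /=.
rewrite lebesgue_measure_cball// -nuh; last exact: measurable_cball.
rewrite muleA; congr (_ * _).
rewrite inver mulrn_eq0/= gt_eqF// -EFinM; congr EFin.
by field; rewrite gt_eqF.
Qed.

End closed_balls.

(** * Counting prefixes by the mass of balls *)

Section counting_and_balls.
Local Open Scope charge_scope.
Local Open Scope ereal_scope.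
Context {R : realType}.
Local Notation lam := (@lebesgue_measure R).
Variable beta : R.
Hypothesis beta_gt1 : (1 < beta)%R.
Hypothesis beta_lt2 : (beta < 2)%R.
Let beta_gt0 : (0 < beta)%R. Proof. by rewrite (lt_trans _ beta_gt1). Qed.
Let betaB1_gt0 : (0 < beta - 1)%R. Proof. by rewrite subr_gt0. Qed.

(** The length of [beta^-n * Ibeta beta], the set of remainders after [n] digits. *)
Definition radius (n : nat) : R := (beta ^- n * (beta - 1)^-1)%R.

Lemma radius_gt0 n : (0 < radius n)%R.
Proof. by rewrite mulr_gt0// invr_gt0 ?exprn_gt0. Qed.

Lemma radius_cvg0 : radius n @[n --> \oo] --> (0%R : R).
Proof.
rewrite -(mul0r (beta - 1)^-1%R); apply: cvgMr_tmp; exact: betaVn_cvg0.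
Qed.

Lemma preimage_cball_affine n (x c : R) :
  (fun y => beta^-1 * (c + y))%R @^-1` cball x (radius n.+1) =
  cball (beta * x - c)%R (radius n).
Proof.
have E y : (`|beta^-1 * (c + y) - x| <= radius n.+1)%R =
    (`|y - (beta * x - c)| <= radius n)%R.
  rewrite /radius exprS invfM -[in LHS]mulrA ler_pdivlMl//.
  rewrite -[X in (X * _)%R](gtr0_norm beta_gt0) -normrM mulrBr mulrA mulfV ?gt_eqF//.
  by rewrite mul1r opprB addrCA addrA.
by apply/seteqP; split=> y; rewrite /cball/= E.
Qed.

(** A word of length [m >= n] extending a prefix counted at [x] has its value within
    [radius n] of [x].  The induction follows the first-digit recursions of both
    sides; the base case holds because two points of [Ibeta beta] are at distance at
    most [radius 0]. *)
Lemma nb_prefixes_le_bernoulli_approx n m (x : R) : (n <= m)%N ->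
  (2 ^- n * (nb_prefixes n beta x)%:R)%:E <=
  bernoulli_approx beta m (cball x (radius n)).
Proof.
elim: n m x => [|n IH] m x nm.
  rewrite nb_prefixes0// expr0 invr1 mul1r.
  have [xI|_] := boolP (x \in _); last exact: measure_ge0.
  rewrite bernoulli_approx_supp// => y /mem_set; rewrite cballE /=.
  move: xI; rewrite /Ibeta !mem_setE !in_itv/= /radius expr0 invr1 mul1r; lra.
case: m nm => // m nm.
rewrite nb_prefixes_first_digit// bernoulli_approx_first_digit//.
have -> : (fun y => beta^-1 * y)%R @^-1` cball x (radius n.+1) =
    cball (beta * x)%R (radius n).
  have := preimage_cball_affine n x 0; rewrite subr0 => <-.
  by apply/seteqP; split=> y; rewrite /= add0r.
rewrite preimage_cball_affine natrD exprS invfM -mulrA mulrDr EFinM.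
by rewrite lee_pmul2l// ?lte_fin ?invr_gt0// EFinD leeD// IH.
Qed.

Variable nu : probability (measurableTypeR R) R.
Hypothesis nu_beta : is_bernoulli_convolution beta nu.

(** Division by the radius, not by the length of the ball, makes [ball_ratio] an
    upper bound of [fn] with constant [1] and integral [2]. *)
Definition ball_ratio n (x : R) : \bar R := (radius n)^-1%:E * nu (cball x (radius n)).

Lemma ball_ratio_ge0 n x : 0 <= ball_ratio n x.
Proof. by rewrite mule_ge0// lee_fin invr_ge0 ltW// radius_gt0. Qed.

Lemma ball_ratio_fin_num n x : ball_ratio n x \is a fin_num.
Proof. by rewrite fin_numM// fin_num_measure//; exact: measurable_cball. Qed.

Lemma measurable_ball_ratio n : measurable_fun setT (ball_ratio n).
Proof. by apply: emeasurable_funM => //; exact: measurable_fun_cball. Qed.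

Lemma integral_ball_ratio n : \int[lam]_x ball_ratio n x = 2%:E.
Proof.
rewrite ge0_integralZl//; last 2 first.
- exact: measurable_fun_cball.
- by rewrite lee_fin invr_ge0 ltW// radius_gt0.
rewrite integral_measure_cball ?radius_gt0// -EFinM; congr EFin.
by rewrite mulrnAr mulVf// gt_eqF// radius_gt0.
Qed.

(** Letting the level of the approximations tend to infinity with the ball fixed is
    allowed because the ball is closed. *)
Lemma fn_le_ball_ratio n x : (fn beta n x)%:E <= ball_ratio n x.
Proof.
have -> : (fn beta n x)%:E =
    (radius n)^-1%:E * (2 ^- n * (nb_prefixes n beta x)%:R)%:E.
  rewrite -EFinM /fn /radius; congr EFin; rewrite invfM !invrK; ring.
rewrite lee_pmul2l// ?lte_fin ?invr_gt0 ?radius_gt0//.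
have cballE0 : cball x (radius n) = [set y | (`|y - x| - radius n <= 0)%R].
  by apply/seteqP; split=> y; rewrite /cball/= subr_le0.
rewrite cballE0; apply: (weak_limit_closed nu_beta).
  move=> y; apply: cvgB; last exact: cvg_cst.
  by apply: cvg_norm; apply: cvgB => //; exact: cvg_cst.
by exists n => // m /= nm; rewrite -cballE0; exact: nb_prefixes_le_bernoulli_approx.
Qed.

(** Upper bound: [fbar] is at most the limit of [ball_ratio], whose integral is that
    of twice the density of [nu].  Lower bound: Fatou's lemma for
    [ball_ratio n - fn n >= 0], of integral [1], prevents more than half of the mass
    [2] from being lost. *)
Lemma integral_fbar_bounds : nu `<< lam ->
  \int[lam]_x fbar beta x <= 2%:E /\ 1 <= \int[lam]_x fbar beta x.
Proof.
move=> nu_lam; pose rn := charge_of_finite_measure nu.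
have rn_lam : rn `<< lam by [].
pose h x := fine (('d rn '/d lam) x).
have hE x : (h x)%:E = ('d rn '/d lam) x.
  by rewrite fineK// Radon_Nikodym_fin_num.
have ih : lam.-integrable setT (EFin \o h).
  rewrite (_ : EFin \o h = ('d rn '/d lam)); last exact/funext.
  exact: Radon_Nikodym_integrable.
have nuh (A : set (measurableTypeR R)) : measurable A -> nu A = \int[lam]_(x in A) (h x)%:E.
  move=> mA; under eq_integral do rewrite hE.
  exact: (Radon_Nikodym_integral rn_lam mA).
(* [K] and [k] both agree almost everywhere with twice the density; defined through
   [ball_ratio], they are nonnegative and comparable with [fbar] and [fn] without
   exceptional sets *)
pose K x := limn_esup (ball_ratio ^~ x); pose k x := limn_einf (ball_ratio ^~ x).
have cvg_ball_ratio := density_cvg_cball ih nuh radius_gt0 radius_cvg0.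
have mK : measurable_fun setT K.
  by apply: measurable_fun_limn_esup => n; exact: measurable_ball_ratio.
have mk : measurable_fun setT k.
  by apply: measurable_fun_limn_einf => n; exact: measurable_ball_ratio.
have int2h : \int[lam]_x (2 * h x)%:E = 2%:E.
  under eq_integral do rewrite EFinM.
  rewrite integralZl// -(nuh setT)//.
  by rewrite probability_setT mule1.
have m2h : measurable_fun setT (fun x => (2 * h x)%:E).
  apply/measurable_EFinP; apply: measurable_funM => //.
  by apply/measurable_EFinP; exact: measurable_int ih.
have intK : \int[lam]_x K x = 2%:E.
  rewrite -int2h; apply: ae_eq_integral => //.
  move: cvg_ball_ratio; apply: filter_app; first exact: (ae_filter_ringOfSetsType lam).
  by apply: aeW => /= x cx _; exact: (cvg_limn_einf_sup cx).2.
have intk : \int[lam]_x k x = 2%:E.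
  rewrite -int2h; apply: ae_eq_integral => //.
  move: cvg_ball_ratio; apply: filter_app; first exact: (ae_filter_ringOfSetsType lam).
  by apply: aeW => /= x cx _; exact: (cvg_limn_einf_sup cx).1.
split.
  rewrite -intK; apply: ge0_le_integral => //.
  - by move=> x _; exact: fbar_ge0.
  - exact: measurable_fbar.
  - by move=> x _; apply: le_limn_esup => n; exact: fn_le_ball_ratio.
pose g n x := ball_ratio n x - (fn beta n x)%:E.
have g0 n x : 0 <= g n x by rewrite sube_ge0 ?fn_le_ball_ratio.
have gfn n x : g n x + (fn beta n x)%:E = ball_ratio n x by rewrite subeK.
have mg n : measurable_fun setT (g n).
  by apply: emeasurable_funB; [exact: measurable_ball_ratio|exact: measurable_fn].
have intg n : \int[lam]_x g n x = 1.
  have : \int[lam]_x g n x + 1 = 2%:E.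
    rewrite -(integral_fn beta_gt1 beta_lt2 n) -ge0_integralD//.
    - transitivity (\int[lam]_x ball_ratio n x); last exact: integral_ball_ratio.
      by apply: eq_integral => x _; exact: gfn.
    - exact: mg.
    - by move=> x _; rewrite lee_fin fn_ge0.
    - exact: measurable_fn.
  move=> g2; rewrite -[LHS](@addeK _ 1)// g2 -EFinB; congr EFin; lra.
have mlg : measurable_fun setT (fun x => limn_einf (g ^~ x)).
  exact: measurable_fun_limn_einf.
have : 2%:E <= 1 + \int[lam]_x fbar beta x.
  rewrite -intk.
  apply: (@le_trans _ _ (\int[lam]_x (limn_einf (g ^~ x) + fbar beta x))).
    apply: ge0_le_integral => //.
    - by move=> x _; apply: limn_einf_ge0 => n; exact: ball_ratio_ge0.
    - by apply: emeasurable_funD => //; exact: measurable_fbar.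
    - move=> x _; rewrite /k.
      have -> : ball_ratio ^~ x = (fun n => g n x + (fn beta n x)%:E).
        by apply/funext => n; rewrite gfn.
      by apply: limn_einf_leD => // n; rewrite lee_fin fn_ge0.
  rewrite ge0_integralD//; last 3 first.
  - by move=> x _; exact: limn_einf_ge0.
  - by move=> x _; exact: fbar_ge0.
  - exact: measurable_fbar.
  rewrite leeD2r//; apply: le_trans (fatou _ _ _ _) _ => //.
  under [X in limn_einf X]eq_fun do rewrite intg.
  by rewrite (cvg_limn_einf_sup (cvg_cst (1 : \bar R))).1.
rewrite -leeBlDl//; apply: le_trans.
by rewrite -EFinB lee_fin lerBrDr.
Qed.

End counting_and_balls.

(** * The density of the Bernoulli convolution *)

Section density_of_bernoulli_convolution.
Local Open Scope ereal_scope.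
Context {R : realType}.
Local Notation lam := (@lebesgue_measure R).
Variable beta : R.
Hypothesis beta_gt1 : (1 < beta)%R.
Hypothesis beta_lt2 : (beta < 2)%R.
Variable nu : probability (measurableTypeR R) R.
Hypothesis nu_beta : is_bernoulli_convolution beta nu.
Let J := \int[lam]_x fbar beta x.

(** [fbar / J] is fixed by [transfer] almost everywhere, since [fbar] is and
    [transfer] is linear, and it has total mass [1]. *)
Lemma fbar_density : 0 < J -> J < +oo ->
  forall A : set (measurableTypeR R), measurable A ->
    nu A = \int[lam]_(x in A) (fbar beta x / J).
Proof.
move=> J0 Jy.
have f0 x : 0 <= fbar beta x := fbar_ge0 beta_gt1 x.
have mf : measurable_fun setT (fbar beta) := measurable_fbar beta_gt1 beta_lt2.
have Jfin : J \is a fin_num by rewrite ge0_fin_numE// ltW.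
have [j jE] : exists j, J = j%:E by exists (fine J); rewrite fineK.
have j0 : (0 < j)%R by rewrite -lte_fin -jE.
have JV : J^-1 = j^-1%:E by rewrite jE inver gt_eqF.
have JV0 : 0 <= J^-1 by rewrite JV lee_fin invr_ge0 ltW.
have f0' x : 0 <= fbar beta x / J by rewrite mule_ge0.
have mf' : measurable_fun setT (fun x => fbar beta x / J) by exact: emeasurable_funM.
apply: (@fixed_density_bernoulli _ beta beta_gt1) => //.
- by move=> x xI; rewrite fbar_out// mul0e.
- rewrite JV ge0_integralZr//; last by rewrite lee_fin invr_ge0 ltW.
  by rewrite -/J jE -EFinM mulfV// gt_eqF.
have : {ae lam, forall x, setT x -> fbar beta x = transfer beta (fbar beta) x}.
  exact: fbar_transfer_ae.
apply: filter_app; first exact: (ae_filter_ringOfSetsType lam).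
apply: aeW => /= x fx _; rewrite /transfer [in LHS]fx// /transfer.
by rewrite -ge0_muleDl// muleA.
Qed.

End density_of_bernoulli_convolution.

Local Open Scope ereal_scope.
Local Open Scope charge_scope.

Theorem theorem2p1 (R : realType) (beta : R)
    (beta_gt1 : (1 < beta)%R) (beta_lt2 : (beta < 2)%R)
    (nu : probability (measurableTypeR R) R)
    (nu_beta : is_bernoulli_convolution beta nu) :
  let lam := @lebesgue_measure R in
  let J := \int[lam]_(x in Ibeta beta) fbar beta x in
  (nu `<< lam <-> 0 < J /\ J < +oo) /\
  (nu `<< lam ->
    J <= 2%:E /\
    {ae lam, forall x, Ibeta beta x ->
      ('d (charge_of_finite_measure nu) '/d lam) x = fbar beta x / J}).
Proof.
move=> lam J.
have JE : J = \int[lam]_x fbar beta x by exact: integral_fbarT.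
have density := fbar_density beta_gt1 beta_lt2 nu_beta; rewrite -JE in density.
have bounds : nu `<< lam -> J <= 2%:E /\ 1 <= J.
  by rewrite JE; exact: integral_fbar_bounds.
have mfJ : measurable_fun setT (fun x => fbar beta x / J).
  by apply: emeasurable_funM => //; exact: measurable_fbar.
have pos_fin : nu `<< lam -> 0 < J /\ J < +oo.
  move=> /bounds[J2 J1]; split; first exact: lt_le_trans J1.
  by rewrite (le_lt_trans J2)// ltry.
split.
  split=> // -[J0 Jy]; apply/null_content_dominatesP => A mA A0.
  rewrite density//; apply: null_set_integral => //.
  exact: measurable_funTS.
move=> nu_lam; have [J0 Jy] := pos_fin nu_lam; split; first by have [] := bounds nu_lam.
pose rn := charge_of_finite_measure nu.
have rn_lam : rn `<< lam by [].
have : {ae lam, forall x, setT x -> ('d rn '/d lam) x = fbar beta x / J}.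
  apply: integral_ae_eq => //.
  - exact: Radon_Nikodym_integrable.
  move=> E _ mE; rewrite -density//.
  by rewrite -(Radon_Nikodym_integral rn_lam mE).
apply: filter_app.
by apply: aeW => x /= h _; exact: h.
Qed.
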